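(* Fix the target and clutter conditions and all radar parameters except the transmitted power $P_{tx}\in(0,\infty)$, and consider $$P_{DC}(P_{tx})=\exp\left(\frac{-N_s\gamma}{P_{tx}\,\mathcal{H}(r_t)\,\sigma_{t_{avg}}}\right)I_{conv},\qquad I_{conv}=\exp\left(-\rho\,r_t\,\Delta r\int_0^{2\pi}(1-J(\theta_c))\,d\theta_c\right).$$ Then $P_{DC}$ converges to $I_{conv}$ as $P_{tx}$ increases to infinity, and the transmitted power $P_{tx}^{max}$ at which $P_{DC}$ reaches the fraction $e^{-0.01}$ (about $99\%$) of its convergence value, i.e. $P_{DC}(P_{tx}^{max})=I_{conv}\,e^{-0.01}$, is $$P_{tx}^{max}=\frac{100\,N_s\,\gamma}{\mathcal{H}(r_t)\,\sigma_{t_{avg}}}.$$ In particular $P_{tx}^{max}$ does not depend on the clutter parameters $\rho$, $\sigma_{c_{avg}}$ and $\alpha$.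
   Context: Positive constants: noise power $N_s$, SCNR threshold $\gamma$, target distance $r_t$, path loss $\mathcal{H}(r_t)$ at the target, mean target cross-section $\sigma_{t_{avg}}$, clutter density $\rho$, range cell size $\Delta r$. The antenna gain $G:[0,2\pi)\to[0,\infty)$ is measurable, and $$J(\theta_c)=\int_0^\infty \exp\left(\frac{-\gamma\,G(\theta_c)\,\sigma_c}{\sigma_{t_{avg}}}\right)P(\sigma_c)\,d\sigma_c,\qquad P(\sigma_c)=\frac{\alpha}{\sigma_{c_{avg}}}\left(\frac{\sigma_c}{\sigma_{c_{avg}}}\right)^{\alpha-1}\exp\left(-\left(\frac{\sigma_c}{\sigma_{c_{avg}}}\right)^{\alpha}\right),$$ with Weibull parameters $\alpha>0$, $\sigma_{c_{avg}}>0$; $J$ does not depend on $P_{tx}$. $P_{DC}$ is the radar detection coverage probability, i.e. the probability that the signal to clutter and noise ratio of a target with exponentially distributed cross-section is at least $\gamma$ in Poisson clutter; the displayed formula is its expression. *)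

(* Defs.v *)
From mathcomp Require Import all_boot all_order all_algebra.
From mathcomp Require Import all_classical all_reals all_analysis.

Set Implicit Arguments.
Unset Strict Implicit.
Unset Printing Implicit Defensive.

Import Order.TTheory GRing.Theory Num.Theory.
Import numFieldNormedType.Exports.

Local Open Scope classical_set_scope.
Local Open Scope ring_scope.

(* For alpha < 1 the density is unbounded near 0; its value at 0 itself, where
   [0 `^ (alpha - 1) = 0] by convention, does not affect integrals. *)
Definition weibull_density (R : realType) (alpha sigma_cavg sigma_c : R) : R :=
  alpha / sigma_cavg * (sigma_c / sigma_cavg) `^ (alpha - 1)
  * expR (- (sigma_c / sigma_cavg) `^ alpha).

Definition J (R : realType) (gamma sigma_tavg : R) (G : R -> R)
    (alpha sigma_cavg theta_c : R) : R :=
  \int[@lebesgue_measure R]_(sigma_c in `[0, +oo[)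
    (expR (- (gamma * G theta_c * sigma_c) / sigma_tavg)
     * weibull_density alpha sigma_cavg sigma_c).

Definition I_conv (R : realType) (gamma r_t sigma_tavg Delta_r : R)
    (G : R -> R) (rho sigma_cavg alpha : R) : R :=
  expR (- rho * r_t * Delta_r
        * \int[@lebesgue_measure R]_(theta_c in `[0, 2 * pi[)
            (1 - J gamma sigma_tavg G alpha sigma_cavg theta_c)).

(* [Hloss] is the path loss as a function of distance. *)
Definition P_DC (R : realType) (N_s gamma r_t : R) (Hloss : R -> R)
    (sigma_tavg Delta_r : R) (G : R -> R) (rho sigma_cavg alpha P_tx : R) : R :=
  expR (- (N_s * gamma) / (P_tx * Hloss r_t * sigma_tavg))
  * I_conv gamma r_t sigma_tavg Delta_r G rho sigma_cavg alpha.

Definition is_P_tx_max (R : realType) (N_s gamma r_t : R) (Hloss : R -> R)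
    (sigma_tavg Delta_r : R) (G : R -> R) (rho sigma_cavg alpha p : R) : Prop :=
  0 < p /\
  P_DC N_s gamma r_t Hloss sigma_tavg Delta_r G rho sigma_cavg alpha p
  = I_conv gamma r_t sigma_tavg Delta_r G rho sigma_cavg alpha
    * expR (- (1 / 100)).

(* Main.v *)
Require Import Defs.
From mathcomp Require Import all_boot all_order all_algebra.
From mathcomp Require Import all_classical all_reals all_analysis.
From mathcomp Require Import ring.

Set Implicit Arguments.
Unset Strict Implicit.
Unset Printing Implicit Defensive.

Import Order.TTheory GRing.Theory Num.Theory.
Import numFieldNormedType.Exports.

Local Open Scope classical_set_scope.
Local Open Scope ring_scope.

(** [P_tx] enters [P_DC] only through the noise factor [expR (- c / P_tx)], with [c = N_s * gamma /
    (Hloss r_t * sigma_tavg)]; clutter enters only through the factor [I_conv]. The noise factor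
    tends to [expR 0 = 1], which gives the limit ([cvg_P_DC]). Being an exponential, [I_conv] is
    nonzero and cancels from the defining equation of the maximal power; injectivity of [expR]
    leaves [c / p = 1 / 100], whose only solution is [p = 100 * c] ([is_P_tx_maxE]). No clutter
    parameter survives the cancellation. *)

Lemma is_P_tx_maxE (R : realType)
    (N_s gamma r_t : R) (Hloss : R -> R) (sigma_tavg Delta_r : R) (G : R -> R)
    (rho sigma_cavg alpha p : R) :
  0 < N_s -> 0 < gamma -> 0 < Hloss r_t -> 0 < sigma_tavg ->
  is_P_tx_max N_s gamma r_t Hloss sigma_tavg Delta_r G rho sigma_cavg alpha p
  <-> p = 100 * N_s * gamma / (Hloss r_t * sigma_tavg).
Proof.
move=> N_s_gt0 gamma_gt0 Hloss_gt0 sigma_gt0.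
have H_neq0 := lt0r_neq0 Hloss_gt0.
have sigma_neq0 := lt0r_neq0 sigma_gt0.
rewrite /is_P_tx_max /P_DC; split=> [[p_gt0]|->].
- have p_neq0 := lt0r_neq0 p_gt0.
  have I_neq0 : I_conv gamma r_t sigma_tavg Delta_r G rho sigma_cavg alpha != 0.
    by rewrite lt0r_neq0 ?expR_gt0.
  rewrite mulrC => /(mulfI I_neq0)/expR_inj exponents.
  (* [N_s] is written in terms of the exponent of the noise factor, so that [exponents] can replace
     that exponent by [- (1 / 100)] and leave an identity of fractions in [p]. *)
  have -> : N_s = - (- (N_s * gamma) / (p * Hloss r_t * sigma_tavg))
                  * (p * Hloss r_t * sigma_tavg) / gamma.
    by field; rewrite H_neq0 p_neq0 sigma_neq0 lt0r_neq0.
  by rewrite exponents; field; rewrite H_neq0 sigma_neq0 lt0r_neq0.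
- split; first by rewrite divr_gt0 ?mulr_gt0.
  rewrite mulrC; congr (_ * expR _); field.
  by rewrite H_neq0 sigma_neq0 !lt0r_neq0.
Qed.

Lemma cvg_P_DC (R : realType)
    (N_s gamma r_t : R) (Hloss : R -> R) (sigma_tavg Delta_r : R) (G : R -> R)
    (rho sigma_cavg alpha : R) :
  P_DC N_s gamma r_t Hloss sigma_tavg Delta_r G rho sigma_cavg alpha P_tx
    @[P_tx --> +oo]
    --> I_conv gamma r_t sigma_tavg Delta_r G rho sigma_cavg alpha.
Proof.
rewrite /P_DC; set I := I_conv _ _ _ _ _ _ _ _.
rewrite -[X in _ --> X]mul1r -expR0; apply: cvgMr_tmp.
apply: continuous_cvg; first exact: continuous_expR.
(* The exponent becomes [P_tx^-1] times a constant, so only [P_tx^-1 --> 0] remains to be shown; the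
   limit 0 is then put in the matching form of 0 times that constant. *)
under eq_fun do rewrite -mulrA invfM mulrCA.
rewrite -(mul0r (- (N_s * gamma) / (Hloss r_t * sigma_tavg))); apply: cvgMr_tmp.
by apply/gtr0_cvgV0; [exact: nbhs_pinfty_gt | exact: cvg_id].
Qed.

Theorem corollary1p3 (R : realType)
    (N_s gamma r_t : R) (Hloss : R -> R) (sigma_tavg Delta_r : R) (G : R -> R)
    (rho sigma_cavg alpha : R)
    (N_s_gt0 : 0 < N_s) (gamma_gt0 : 0 < gamma) (r_t_gt0 : 0 < r_t)
    (Hloss_gt0 : 0 < Hloss r_t) (sigma_tavg_gt0 : 0 < sigma_tavg)
    (Delta_r_gt0 : 0 < Delta_r)
    (G_meas : measurable_fun `[0, 2 * pi[ G)
    (G_ge0 : forall theta : R, 0 <= theta < 2 * pi -> 0 <= G theta)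
    (rho_gt0 : 0 < rho) (sigma_cavg_gt0 : 0 < sigma_cavg)
    (alpha_gt0 : 0 < alpha) :
  [/\ P_DC N_s gamma r_t Hloss sigma_tavg Delta_r G rho sigma_cavg alpha P_tx
        @[P_tx --> +oo]
        --> I_conv gamma r_t sigma_tavg Delta_r G rho sigma_cavg alpha,
      forall p : R,
        is_P_tx_max N_s gamma r_t Hloss sigma_tavg Delta_r G
          rho sigma_cavg alpha p
        <-> p = 100 * N_s * gamma / (Hloss r_t * sigma_tavg)
    & forall rho' sigma_cavg' alpha' : R,
        0 < rho' -> 0 < sigma_cavg' -> 0 < alpha' ->
        forall p p' : R,
          is_P_tx_max N_s gamma r_t Hloss sigma_tavg Delta_r G
            rho sigma_cavg alpha p ->
          is_P_tx_max N_s gamma r_t Hloss sigma_tavg Delta_r G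
            rho' sigma_cavg' alpha' p' ->
          p = p'].
Proof.
split=> [|p|rho' sigma_cavg' alpha' _ _ _ p p'].
- exact: cvg_P_DC.
- exact: is_P_tx_maxE.
(* Both powers equal the same closed form, in which [rho], [sigma_cavg] and [alpha] do not occur. *)
- by rewrite !is_P_tx_maxE // => -> ->.
Qed.
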